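(* Let $\alpha_0,\alpha_1,\alpha_2$ be complex parameters with $\alpha_0+\alpha_1+\alpha_2=\frac12$. Consider a polynomial Hamiltonian system $\frac{dq_i}{dt}=\frac{\partial H}{\partial p_i}$, $\frac{dp_i}{dt}=-\frac{\partial H}{\partial q_i}$ ($i=1,2$) with Hamiltonian $H\in\mathbb{C}(t)[q_1,p_1,q_2,p_2]$. Assume that (A1) $\deg(H)=3$ with respect to $q_1,p_1,q_2,p_2$; (A2) this system becomes again a polynomial Hamiltonian system in each of the coordinate systems $r_i$ ($i=0,1,2$): $$r_0:\ x_0=\tfrac1{q_1},\quad y_0=-\left(\left(p_1+\tfrac{q_2^2}{4}\right)q_1+\alpha_0\right)q_1,\quad z_0=q_2,\quad w_0=p_2+\tfrac{q_1q_2}{2};$$ $$r_1:\ x_1=q_1,\quad y_1=p_1,\quad z_1=\tfrac1{q_2},\quad w_1=-(q_2p_2+\alpha_1)q_2;$$ $$r_2:\ x_2=\tfrac1{q_1},\quad y_2=-\left(\left(p_1+2p_2+t+q_1q_2-\tfrac{q_2^2}{4}\right)q_1+\alpha_2\right)q_1,\quad z_2=q_2-2q_1,\quad w_2=p_2+\tfrac{q_1^2}{2}-\tfrac{q_2^2}{8}.$$ Then the system coincides with the system $$\begin{aligned} \frac{dq_1}{dt}&=2q_1^2+4p_1+2t+4p_2,\\ \frac{dp_1}{dt}&=-4q_1p_1+2q_2p_2-2\alpha_0,\\ \frac{dq_2}{dt}&=q_2^2-4p_2+4p_1-2q_1q_2,\\ \frac{dp_2}{dt}&=-2q_2p_2+2q_1p_2-\alpha_1,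 \end{aligned}$$ with polynomial Hamiltonian $2(q_1^2p_1+p_1^2+tp_1+\alpha_0q_1)+q_2^2p_2-2p_2^2+\alpha_1q_2+4p_1p_2-2q_1q_2p_2$.
   Context: Condition (A2) is to be read as follows: writing $r_j(K)$ for the expression of $K$ in the coordinates $(x_j,y_j,z_j,w_j)$ (obtained by inverting the birational map $r_j$), the functions $r_0(H)$, $r_1(H)$ and $r_2(H-q_1)$ are polynomials in $x_j,y_j,z_j,w_j$ (for $j=0,1,2$ respectively), with coefficients in $\mathbb{C}(t)$. The correction $-q_1$ accounts for the explicit $t$-dependence of $r_2$. *)

(* Defs.v *)
From HB Require Import structures.
From mathcomp Require Import all_boot all_order all_algebra fraction ring.
From mathcomp Require Import reals complex mpoly.

Set Implicit Arguments.
Unset Strict Implicit.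
Unset Printing Implicit Defensive.

Import GRing.Theory.
Local Open Scope ring_scope.

(* The field C(t), where C = R[i] and t = tvar. *)
Definition Ct (R : realType) : fieldType := {fraction {poly R[i]}}.

Definition tvar (R : realType) : Ct R := tofrac 'X.

Definition cst (R : realType) (a : R[i]) : Ct R := tofrac a%:P.

(* Indices of the variables, always listed in the order (q1, p1, q2, p2);
   the same four indeterminates stand for (x_j, y_j, z_j, w_j) in the j-th
   coordinate system. *)
Definition iq1 : 'I_4 := @Ordinal 4 0 isT.
Definition ip1 : 'I_4 := @Ordinal 4 1 isT.
Definition iq2 : 'I_4 := @Ordinal 4 2 isT.
Definition ip2 : 'I_4 := @Ordinal 4 3 isT.

Definition point (F : Type) : Type := (F * F * F * F)%type.

Definition coord (F : Type) (v : point F) (i : 'I_4) : F :=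
  let: (a, b, c, d) := v in tnth [tuple a; b; c; d] i.

(* The birational maps (q1, p1, q2, p2) |-> (x_j, y_j, z_j, w_j), over an
   arbitrary field containing the parameters and t. *)
Definition r0 (F : fieldType) (a0 : F) (v : point F) : point F :=
  let: (q1, p1, q2, p2) := v in
  (1 / q1,
   - (((p1 + q2 ^+ 2 / 4) * q1 + a0) * q1),
   q2,
   p2 + q1 * q2 / 2).

Definition r1 (F : fieldType) (a1 : F) (v : point F) : point F :=
  let: (q1, p1, q2, p2) := v in
  (q1,
   p1,
   1 / q2,
   - ((q2 * p2 + a1) * q2)).

Definition r2 (F : fieldType) (a2 t : F) (v : point F) : point F :=
  let: (q1, p1, q2, p2) := v in
  (1 / q1,
   - (((p1 + 2 * p2 + t + q1 * q2 - q2 ^+ 2 / 4) * q1 + a2) * q1),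
   q2 - 2 * q1,
   p2 + q1 ^+ 2 / 2 - q2 ^+ 2 / 8).

(* The inverses of r0, r1, r2, solved explicitly for (q1, p1, q2, p2); the
   lemmas r0K, r0_invK, etc. check them. *)
Definition r0_inv (F : fieldType) (a0 : F) (u : point F) : point F :=
  let: (x, y, z, w) := u in
  (1 / x,
   - ((x * y + a0) * x) - z ^+ 2 / 4,
   z,
   w - z / (2 * x)).

Definition r1_inv (F : fieldType) (a1 : F) (u : point F) : point F :=
  let: (x, y, z, w) := u in
  (x,
   y,
   1 / z,
   - ((z * w + a1) * z)).

Definition r2_inv (F : fieldType) (a2 t : F) (u : point F) : point F :=
  let: (x, y, z, w) := u in
  let q1 := 1 / x in
  let q2 := z + 2 * q1 in
  let p2 := w - q1 ^+ 2 / 2 + q2 ^+ 2 / 8 in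
  (q1,
   - ((x * y + a2) * x) - 2 * p2 - t - q1 * q2 + q2 ^+ 2 / 4,
   q2,
   p2).

Lemma two_neq0_pow (F : fieldType) : (2 : F) != 0 ->
  (4 : F) != 0 /\ (8 : F) != 0.
Proof.
move=> h2; split.
  by rewrite (_ : 4 = 2 * 2 :> F) ?mulf_neq0 //; ring.
by rewrite (_ : 8 = 2 * (2 * 2) :> F) ?mulf_neq0 //; ring.
Qed.

Lemma r0K (F : fieldType) (a0 : F) (v : point F) :
  (2 : F) != 0 -> coord v iq1 != 0 -> r0_inv a0 (r0 a0 v) = v.
Proof.
case: v => [[[q1 p1] q2] p2] h2; have [h4 h8] := two_neq0_pow h2.
rewrite /coord /tnth /= => h.
by congr (_, _, _, _); field; rewrite ?h ?oner_neq0 ?h2 ?h4 ?h8.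
Qed.

Lemma r0_invK (F : fieldType) (a0 : F) (u : point F) :
  (2 : F) != 0 -> coord u iq1 != 0 -> r0 a0 (r0_inv a0 u) = u.
Proof.
case: u => [[[x y] z] w] h2; have [h4 h8] := two_neq0_pow h2.
rewrite /coord /tnth /= => h.
by congr (_, _, _, _); field; rewrite ?h ?oner_neq0 ?h2 ?h4 ?h8.
Qed.

Lemma r1K (F : fieldType) (a1 : F) (v : point F) :
  coord v iq2 != 0 -> r1_inv a1 (r1 a1 v) = v.
Proof.
case: v => [[[q1 p1] q2] p2]; rewrite /coord /tnth /= => h.
by congr (_, _, _, _); field; rewrite ?h ?oner_neq0.
Qed.

Lemma r1_invK (F : fieldType) (a1 : F) (u : point F) :
  coord u iq2 != 0 -> r1 a1 (r1_inv a1 u) = u.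
Proof.
case: u => [[[x y] z] w]; rewrite /coord /tnth /= => h.
by congr (_, _, _, _); field; rewrite ?h ?oner_neq0.
Qed.

Lemma r2K (F : fieldType) (a2 t : F) (v : point F) :
  (2 : F) != 0 -> coord v iq1 != 0 -> r2_inv a2 t (r2 a2 t v) = v.
Proof.
case: v => [[[q1 p1] q2] p2] h2; have [h4 h8] := two_neq0_pow h2.
rewrite /coord /tnth /= => h.
by congr (_, _, _, _); field; rewrite ?h ?oner_neq0 ?h2 ?h4 ?h8.
Qed.

Lemma r2_invK (F : fieldType) (a2 t : F) (u : point F) :
  (2 : F) != 0 -> coord u iq1 != 0 -> r2 a2 t (r2_inv a2 t u) = u.
Proof.
case: u => [[[x y] z] w] h2; have [h4 h8] := two_neq0_pow h2.
rewrite /coord /tnth /= => h.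
by congr (_, _, _, _); field; rewrite ?h ?oner_neq0 ?h2 ?h4 ?h8.
Qed.

(* The field C(t)(q1, p1, q2, p2). *)
Definition Rat (R : realType) : fieldType := {fraction {mpoly (Ct R)[4]}}.

Definition to_rat (R : realType) (P : {mpoly (Ct R)[4]}) : Rat R := tofrac P.

Definition scal (R : realType) (c : Ct R) : Rat R := to_rat c%:MP.

Definition generic (R : realType) : point (Rat R) :=
  (to_rat 'X_iq1, to_rat 'X_ip1, to_rat 'X_iq2, to_rat 'X_ip2).

Definition subst_at (R : realType) (s : point (Rat R)) (K : {mpoly (Ct R)[4]}) :
  Rat R := mmap (@scal R) (coord s) K.

(* The expression r_j(K) of K in the coordinates (x_j, y_j, z_j, w_j), that
   is, the composite of K with the inverse of the birational map r_j. *)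
Definition r0_expr (R : realType) (a0 : R[i]) (K : {mpoly (Ct R)[4]}) : Rat R :=
  subst_at (r0_inv (scal (cst a0)) (generic R)) K.

Definition r1_expr (R : realType) (a1 : R[i]) (K : {mpoly (Ct R)[4]}) : Rat R :=
  subst_at (r1_inv (scal (cst a1)) (generic R)) K.

Definition r2_expr (R : realType) (a2 : R[i]) (K : {mpoly (Ct R)[4]}) : Rat R :=
  subst_at (r2_inv (scal (cst a2)) (scal (tvar R)) (generic R)) K.

Definition is_polynomial (R : realType) (f : Rat R) : Prop :=
  exists P : {mpoly (Ct R)[4]}, f = to_rat P.

(* msize is 1 + the total degree. *)
Definition condA1 (R : realType) (H : {mpoly (Ct R)[4]}) : Prop :=
  msize H = 4%N.

(* The term - q1 accounts for the explicit dependence of r2 on t. *)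
Definition condA2 (R : realType) (a0 a1 a2 : R[i]) (H : {mpoly (Ct R)[4]}) :
  Prop :=
  [/\ is_polynomial (r0_expr a0 H),
      is_polynomial (r1_expr a1 H) &
      is_polynomial (r2_expr a2 (H - 'X_iq1))].

(* A system of differential equations is encoded by its right-hand sides
   (dq1/dt, dp1/dt, dq2/dt, dp2/dt). *)
Definition hamiltonian_system (R : realType) (H : {mpoly (Ct R)[4]}) :
  point {mpoly (Ct R)[4]} :=
  (H^`M(ip1), - H^`M(iq1), H^`M(ip2), - H^`M(iq2)).

Definition target_system (R : realType) (a0 a1 : R[i]) :
  point {mpoly (Ct R)[4]} :=
  let q1 : {mpoly (Ct R)[4]} := 'X_iq1 in
  let p1 : {mpoly (Ct R)[4]} := 'X_ip1 in
  let q2 : {mpoly (Ct R)[4]} := 'X_iq2 in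
  let p2 : {mpoly (Ct R)[4]} := 'X_ip2 in
  let t : {mpoly (Ct R)[4]} := (tvar R)%:MP in
  let al0 : {mpoly (Ct R)[4]} := (cst a0)%:MP in
  let al1 : {mpoly (Ct R)[4]} := (cst a1)%:MP in
  (2 * q1 ^+ 2 + 4 * p1 + 2 * t + 4 * p2,
   - 4 * q1 * p1 + 2 * q2 * p2 - 2 * al0,
   q2 ^+ 2 - 4 * p2 + 4 * p1 - 2 * q1 * q2,
   - 2 * q2 * p2 + 2 * q1 * p2 - al1).

Definition target_hamiltonian (R : realType) (a0 a1 : R[i]) :
  {mpoly (Ct R)[4]} :=
  let q1 : {mpoly (Ct R)[4]} := 'X_iq1 in
  let p1 : {mpoly (Ct R)[4]} := 'X_ip1 in
  let q2 : {mpoly (Ct R)[4]} := 'X_iq2 in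
  let p2 : {mpoly (Ct R)[4]} := 'X_ip2 in
  let t : {mpoly (Ct R)[4]} := (tvar R)%:MP in
  let al0 : {mpoly (Ct R)[4]} := (cst a0)%:MP in
  let al1 : {mpoly (Ct R)[4]} := (cst a1)%:MP in
  2 * (q1 ^+ 2 * p1 + p1 ^+ 2 + t * p1 + al0 * q1)
  + q2 ^+ 2 * p2 - 2 * p2 ^+ 2 + al1 * q2 + 4 * p1 * p2 - 2 * q1 * q2 * p2.

(* Main.v *)
Require Import Defs.
From mathcomp Require Import all_boot all_order all_algebra.
From mathcomp Require Import reals complex mpoly.
From mathcomp Require Import fraction zify ring.
Import Defs GRing.Theory.
Local Open Scope ring_scope.

Set Implicit Arguments.
Unset Strict Implicit.
Unset Printing Implicit Defensive.

(** Each of the three inverse charts writes (q1, p1, q2, p2) as Laurent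
    polynomials in a single variable (x for r0 and r2, z for r1) whose
    coefficients are polynomials in the other three.  Substituting such a
    point into the cubic H gives a Laurent polynomial again, and the chart
    condition says precisely that its polar part vanishes.  Every coefficient
    of the polar part is a linear form in the 35 coefficients of H, so the
    theorem is a linear algebra problem with a triangular solution.

    [laurent_polar_coef_eq0] turns the chart condition, an equality of rational
    functions, into these linear equations: multiply by a high power of the
    distinguished variable, cancel denominators, specialise the remaining
    variables to scalars, and read off low order coefficients of a univariate
    polynomial. [polar_coef] is a form of the same coefficients that evaluates
    by computation. The specialised variables are arbitrary scalars of an
    infinite field, so each equation splits further into the coefficients of
    its powers of them ([horner_rec_eq0]).

    The solution of the linear system runs as follows.  The chart r1 kills all
    monomials that contain q2 but not p2, except for q2 itself, which is tied
    to q2^2 p2 ([r1_coefs]).  The chart r0 then leaves, up to a constant,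
      al (q1^2 p1 + a0 q1 - q1 q2 p2 - p2^2) + la p1^3 + mu p1^2 + nu p1
      + rho (q1 p1^2 - p1 p2 q2 / 2) + sg (q1 p1 - p2 q2 / 2)
      + tau (p1 p2 + (q2^2 p2 + a1 q2) / 4)
    ([r0_coefs]), where al, la, mu, nu, rho, sg, tau are the coefficients of
    q1^2 p1, p1^3, p1^2, p1, q1 p1^2, q1 p1, p1 p2.  In the chart r2, where p1
    has a double pole, the successive pole orders give la = 0, rho = 0, mu = al,
    sg = 0, nu = al t, and the simple pole gives tau = 2 al together with
    al (a0 + a2) + tau a1 / 2 = 1, in which the 1 comes from the correction
    term - q1.  Hence al (a0 + a1 + a2) = 1, and the normalisation of the
    parameters forces al = 2 ([r2_coefs]). *)

(** * Vanishing of polar parts *)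

Lemma mpoly_sum_support (n : nat) (F : nzRingType) (H : {mpoly F[n]})
    (s : seq 'X_{1..n}) (V : lmodType F) (f : 'X_{1..n} -> V) :
  uniq s -> {subset msupp H <= s} ->
  \sum_(m <- msupp H) H@_m *: f m = \sum_(m <- s) H@_m *: f m.
Proof.
move=> us sub; rewrite [RHS](bigID (mem (msupp H))) /= [X in _ + X]big1 ?addr0.
  rewrite -[RHS]big_filter; apply: perm_big; apply: uniq_perm.
  - exact: msupp_uniq.
  - exact: filter_uniq.
  - by move=> m; rewrite mem_filter; case: (boolP (m \in msupp H)) => // /sub.
by move=> m /memN_msupp_eq0 ->; rewrite scale0r.
Qed.

(** If substituting v_i = N_i / X_j^(d_i) into H yields a polynomial P, then
    for D large the polynomial X_j^D * P, which is the sum of the monomials of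
    H with their denominators cancelled, has no term of degree below D in X_j.
    The specialisation h keeps X_j as the variable, and the coefficient of
    degree D - k is the one of X_j^(- k) in the Laurent expansion. *)
Lemma laurent_polar_coef_eq0 (n : nat) (F : fieldType) (H P : {mpoly F[n]})
    (s : seq 'X_{1..n}) (v : 'I_n -> {fraction {mpoly F[n]}})
    (N : 'I_n -> {mpoly F[n]}) (d : 'I_n -> nat) (j : 'I_n)
    (h : 'I_n -> {poly F}) (k : nat) :
  mmap (fun c => tofrac c%:MP) v H = tofrac P ->
  (forall i, v i = tofrac (N i) / tofrac ('X_j ^+ d i)) ->
  uniq s -> {subset msupp H <= s} -> h j = 'X -> (0 < k)%N ->
  \sum_(m <- s | (k <= \sum_i d i * m i)%N) H@_m *
    (\prod_i mmap polyC h (N i) ^+ m i)`_(\sum_i d i * m i - k) = 0.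
Proof.
move=> HP vE us sub hj k_gt0.
pose wt (m : 'X_{1..n}) := (\sum_i d i * m i)%N.
pose D := (\max_(m <- s) wt m + k)%N.
have sD m : m \in s -> (wt m <= D)%N.
  move=> ms; apply: leq_trans (leq_addr _ _).
  by rewrite (big_rem m) //= leq_maxl.
pose X : {mpoly F[n]} := 'X_j.
have XnF e : tofrac (X ^+ e) != 0.
  by rewrite tofrac_eq0 expf_neq0 // -msupp_eq0 msuppX.
have clear_den : \sum_(m <- s) H@_m *:
    (X ^+ (D - wt m) * \prod_i N i ^+ m i) = X ^+ D * P.
  apply/eqP; rewrite -tofrac_eq tofracM -HP /mmap; apply/eqP.
  rewrite -(mpoly_sum_support _ us sub) rmorph_sum big_distrr /=.
  rewrite [LHS]big_seq [RHS]big_seq; apply: eq_bigr => m /sub /sD mD.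
  have ->: mmap1 v m = tofrac (\prod_i N i ^+ m i) / tofrac (X ^+ wt m).
    rewrite /mmap1 (eq_bigr (fun i => tofrac (N i ^+ m i) /
       tofrac (X ^+ (d i * m i)))); last first.
      by move=> i _; rewrite vE expr_div_n -!tofracXn -exprM.
    by rewrite expr_sum !rmorph_prod /= big_split /= prodfV.
  rewrite -{2}(subnK mD) exprD -mul_mpolyC !tofracM.
  (* The generic statement keeps [field] from reducing the fraction field. *)
  have cancelX (K : fieldType) (a b c x : K) :
      x != 0 -> a * (b * c) = b * x * (a * (c / x)) by move=> x0; field.
  exact: cancelX.
have kD : (k <= D)%N by rewrite leq_addl.
have := congr1 (fun p : {mpoly F[n]} => (mmap polyC h p)`_(D - k)) clear_den.
rewrite rmorphM rmorphXn /= mmapX mmap1U hj coefXnM ltn_subrL k_gt0.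
rewrite (leq_trans k_gt0 kD); apply: etrans.
rewrite raddf_sum /= coef_sum big_mkcond [LHS]big_seq [RHS]big_seq.
apply: eq_bigr => m /sD mD.
rewrite mmapZ coefCM rmorphM rmorphXn /= mmapX mmap1U hj rmorph_prod /= coefXnM.
rewrite ltn_sub2lE // ltnNge; case: leqP => [km|_]; last by rewrite mulr0.
congr (_ * (polyseq _)`_ _); last by rewrite -/(wt m); lia.
by apply: eq_bigr => i _; rewrite rmorphXn.
Qed.

(** * Cubic polynomials in four variables *)

Definition mnm4 (i j k l : nat) : 'X_{1..4} :=
  [multinom [tuple i; j; k; l]].

Definition cubic_exponents : seq (point nat) :=
  let prod A (s : seq A) := [seq (u, n) | u <- s, n <- iota 0 4] in
  [seq e <- prod _ (prod _ (prod _ (iota 0 4)))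
     | (e.1.1.1 + e.1.1.2 + e.1.2 + e.2 <= 3)%N].

Definition mnm_point (e : point nat) : 'X_{1..4} :=
  mnm4 e.1.1.1 e.1.1.2 e.1.2 e.2.

Lemma mnm_point_inj : injective mnm_point.
Proof.
move=> [[[i j] k] l] [[[i' j'] k'] l'] /mnmP E.
move: (E iq1) (E ip1) (E iq2) (E ip2); rewrite !multinomE !(tnth_nth 0%N) /=.
by move=> -> -> -> ->.
Qed.

Lemma mem_cubic_monomials (m : 'X_{1..4}) :
  (mdeg m < 4)%N -> m \in map mnm_point cubic_exponents.
Proof.
rewrite mdegE !big_ord_recl big_ord0 addn0.
set i := m _; set j := m _; set k := m _; set l := m _ => deg_m.
apply/mapP; exists (i, j, k, l).
  rewrite mem_filter; apply/andP; split; first by rewrite /= -!addnA.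
  by do 3!(apply: allpairs_f; last by rewrite mem_iota; lia); rewrite mem_iota; lia.
apply/mnmP => u; rewrite multinomE (tnth_nth 0%N) /=.
by case: u => [[|[|[|[|//]]]] u_lt] /=; congr (m _); apply: val_inj.
Qed.

Lemma msupp_cubic (F : nzRingType) (H : {mpoly F[4]}) : (msize H <= 4)%N ->
  {subset msupp H <= map mnm_point cubic_exponents}.
Proof.
move=> degH m /msize_mdeg_lt mH.
by apply: mem_cubic_monomials; apply: leq_trans degH.
Qed.

Lemma cubic_monomials_uniq : uniq (map mnm_point cubic_exponents).
Proof. by rewrite map_inj_uniq //; exact: mnm_point_inj. Qed.

Lemma cubic_mpolyE (F : nzRingType) (H : {mpoly F[4]}) : (msize H <= 4)%N ->
  H = \sum_(e <- cubic_exponents) H@_(mnm_point e) *: 'X_[mnm_point e].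
Proof.
move=> degH; rewrite {1}[H]mpolyE.
rewrite -(big_map mnm_point xpredT (fun m => H@_m *: 'X_[m])).
exact: mpoly_sum_support cubic_monomials_uniq (msupp_cubic degH).
Qed.

Definition weight (d e : point nat) : nat :=
  (d.1.1.1 * e.1.1.1 + d.1.1.2 * e.1.1.2 + d.1.2 * e.1.2 + d.2 * e.2)%N.

Lemma sum_coord_mnm (d e : point nat) :
  (\sum_i coord d i * mnm_point e i)%N = weight d e.
Proof.
case: d => [[[d1 d2] d3] d4].
by rewrite !big_ord_recl big_ord0 !multinomE !(tnth_nth 0%N) /= !addnA addn0.
Qed.

Lemma prod_coord_mnm (A : comNzRingType) (p : point A) (e : point nat) :
  \prod_i coord p i ^+ mnm_point e i =
  p.1.1.1 ^+ e.1.1.1 * p.1.1.2 ^+ e.1.1.2 * p.1.2 ^+ e.1.2 * p.2 ^+ e.2.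
Proof.
case: p => [[[p1 p2] p3] p4].
by rewrite !big_ord_recl big_ord0 !multinomE !(tnth_nth 0%N) /= mulr1 !mulrA.
Qed.

(** * Computable polar coefficients *)

(** The recursion runs on s, so that the computed expressions have no more terms
    than s has entries, whatever k is. *)
Fixpoint convolution (F : nzRingType) (s : seq F) (g : nat -> F) (k : nat) : F :=
  match s, k with
  | [::], _ => 0
  | a :: _, 0 => a * g 0
  | a :: s', k'.+1 => a * g k + convolution s' g k'
  end.

Lemma coef_Poly_mul (F : nzRingType) (s : seq F) (q : {poly F}) (k : nat) :
  (Poly s * q)`_k = convolution s (nth 0 q) k.
Proof.
elim: s k => [|a s IHs] k /=; first by rewrite mul0r coef0; case: k.
rewrite cons_poly_def mulrDl coefD -mulrA -commr_polyX mulrA coefMX coefCM.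
by case: k => [|k] /=; rewrite ?IHs addrC ?addr0.
Qed.

Definition coef_prod (F : nzRingType) (ss : seq (seq F)) : nat -> F :=
  foldr (@convolution F) (nth 0 [:: 1]) ss.

Lemma eq_convolution (F : nzRingType) (s : seq F) (g g' : nat -> F) :
  g =1 g' -> convolution s g =1 convolution s g'.
Proof. by move=> gE; elim: s => [|a s IHs] [|k] //=; rewrite gE ?IHs. Qed.

Lemma coef_prodE (F : nzRingType) (ss : seq (seq F)) (k : nat) :
  coef_prod ss k = (\prod_(s <- ss) Poly s)`_k.
Proof.
elim: ss k => [|s ss IHs] k; first by rewrite big_nil coef1; case: k => [|[]].
by rewrite big_cons coef_Poly_mul; exact: eq_convolution.
Qed.

Definition coef4 (F : nzRingType) (H : {mpoly F[4]}) (i j k l : nat) : F :=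
  H@_(mnm4 i j k l).

(** The coefficient of x^(- k) in the expansion of the polynomial with
    coefficients c at the point whose i-th coordinate is the polynomial with
    coefficient sequence s_i, divided by x^(d_i).  It reduces by computation to
    an explicit linear form in the values of c; it takes a bare function c, not
    a polynomial, so that these values stay opaque to [ring]. *)
Definition polar_coef (F : nzRingType) (c : nat -> nat -> nat -> nat -> F)
    (d : point nat) (s : point (seq F)) (k : nat) : F :=
  \sum_(e <- cubic_exponents | (k <= weight d e)%N)
    c e.1.1.1 e.1.1.2 e.1.2 e.2 *
    coef_prod (nseq e.1.1.1 s.1.1.1 ++ nseq e.1.1.2 s.1.1.2 ++
               nseq e.1.2 s.1.2 ++ nseq e.2 s.2) (weight d e - k).

Lemma polar_coef_chart_eq0 (F : fieldType) (H P : {mpoly F[4]})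
    (v : point {fraction {mpoly F[4]}}) (N : point {mpoly F[4]})
    (d : point nat) (j : 'I_4) (h : point {poly F})
    (s : point (seq F)) (k : nat) :
  (msize H <= 4)%N ->
  mmap (fun c => tofrac c%:MP) (coord v) H = tofrac P ->
  (forall i, coord v i = tofrac (coord N i) / tofrac ('X_j ^+ coord d i)) ->
  (forall i, mmap polyC (coord h) (coord N i) = Poly (coord s i)) ->
  coord h j = 'X -> (0 < k)%N ->
  polar_coef (coef4 H) d s k = 0.
Proof.
move=> degH HP vE hE hj k_gt0.
rewrite -[RHS](laurent_polar_coef_eq0 HP vE cubic_monomials_uniq
  (msupp_cubic degH) hj k_gt0).
rewrite big_map; apply: eq_big => e; rewrite sum_coord_mnm // => _.
rewrite coef_prodE !big_cat /= !big_nseq !iter_mulr_1 !mulrA.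
case: s hE => [[[s1 s2] s3] s4] hE.
rewrite -(prod_coord_mnm (Poly s1, Poly s2, Poly s3, Poly s4)).
congr (_ * (polyseq _)`_ _); apply: eq_bigr => i _; rewrite hE; congr (_ ^+ _).
by case: i => [[|[|[|[|//]]]] ?].
Qed.

(** * Polynomial identities over an infinite field *)

Definition vanishing (F : nzRingType) (s : seq F) : Prop :=
  foldr (fun a => and (a = 0)) True s.

(** Stated with [horner_rec], which computes to an expression that [ring] can
    read, and with a conjunction, which introduction patterns can take apart. *)
Lemma horner_rec_eq0 (F : fieldType) (s : seq F) :
  [pchar F] =i pred0 -> (forall x, horner_rec s x = 0) ->
  vanishing s.
Proof.
move=> char0 s0; have/pcharf0P natE := char0.
have Ps0 : Poly s = 0.
  apply/eqP; apply: contraT => nz.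
  pose rs : seq F := [seq n%:R | n <- iota 0 (size (Poly s))].
  have := max_poly_roots nz (rs := rs); rewrite size_map size_iota ltnn; apply.
    by apply/allP => x _; rewrite rootE horner_Poly s0.
  rewrite map_inj_uniq ?iota_uniq // => m n /eqP; rewrite eq_sym.
  wlog le_mn : m n / (m <= n)%N.
    by move=> W; case/orP: (leq_total m n) => /W // E /[1!eq_sym] /E.
  rewrite -subr_eq0 -natrB // natE subn_eq0 => le_nm.
  by apply/eqP; rewrite eqn_leq le_mn.
elim: s Ps0 {s0} => //= a s IHs; rewrite cons_poly_def => E.
have a0 : a = 0.
  by move: (congr1 (horner^~ 0) E); rewrite hornerMXaddC mulr0 add0r horner0.
split=> //; apply: IHs; move/eqP: E.
by rewrite a0 addr0 mulf_eq0 polyX_eq0 orbF => /eqP.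
Qed.

Lemma horner_rec2_eq0 (F : fieldType) (rows : seq (seq F)) :
  [pchar F] =i pred0 ->
  (forall x y, horner_rec [seq horner_rec r y | r <- rows] x = 0) ->
  foldr (fun r => and (vanishing r)) True rows.
Proof.
move=> char0 rows0.
have {rows0} : forall y, vanishing [seq horner_rec r y | r <- rows].
  by move=> y; apply: horner_rec_eq0.
elim: rows => //= r rows IHrows r0; split.
  by apply: horner_rec_eq0 => // y; case: (r0 y).
by apply: IHrows => y; case: (r0 y).
Qed.

(** * The charts as Laurent points *)

Definition map_point (A B : Type) (f : A -> B) (p : point A) : point B :=
  (f p.1.1.1, f p.1.1.2, f p.1.2, f p.2).

Lemma coord_map_point (A B : Type) (f : A -> B) (p : point A) (i : 'I_4) :
  coord (map_point f p) i = f (coord p i).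
Proof. by case: p => [[[? ?] ?] ?]; case: i => [[|[|[|[|//]]]] ?]. Qed.

(** The numerators of the inverse charts.  The scalar 1/2 is an argument h, so
    that these are expressions in ring operations alone and commute with every
    ring morphism. *)
Definition r0_num (A : comNzRingType) (h a : A) (u : point A) : point A :=
  let: (x, y, z, w) := u in
  (1, - ((x * y + a) * x) - h ^+ 2 * z ^+ 2, z, w * x - h * z).

Definition r1_num (A : comNzRingType) (a : A) (u : point A) : point A :=
  let: (x, y, z, w) := u in (x, y, 1, - ((z * w + a) * z)).

Definition r2_num (A : comNzRingType) (h a t : A) (u : point A) : point A :=
  let: (x, y, z, w) := u in
  (1,
   - ((x * y + a) * x ^+ 3) - (t + 2 * w) * x ^+ 2 - z * x - 1,
   z * x + 2,
   (w + h ^+ 3 * z ^+ 2) * x + h * z).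

Section Morphism.
Variables (A B : comNzRingType) (f : {rmorphism A -> B}).

Lemma r0_num_morph (h a : A) (u : point A) :
  map_point f (r0_num h a u) = r0_num (f h) (f a) (map_point f u).
Proof. by case: u => [[[x y] z] w]; congr (_, _, _, _) => /=; ring. Qed.

Lemma r1_num_morph (a : A) (u : point A) :
  map_point f (r1_num a u) = r1_num (f a) (map_point f u).
Proof. by case: u => [[[x y] z] w]; congr (_, _, _, _) => /=; ring. Qed.

Lemma r2_num_morph (h a t : A) (u : point A) :
  map_point f (r2_num h a t u) = r2_num (f h) (f a) (f t) (map_point f u).
Proof. by case: u => [[[x y] z] w]; congr (_, _, _, _) => /=; ring. Qed.
End Morphism.

Definition quot_point (K : fieldType) (n : point K) (x : K) (d : point nat) :
    point K :=
  let: (n1, n2, n3, n4) := n in let: (d1, d2, d3, d4) := d in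
  (n1 / x ^+ d1, n2 / x ^+ d2, n3 / x ^+ d3, n4 / x ^+ d4).

Section Quotients.
Variables (K : fieldType) (h a t x y z w : K).
Hypotheses (hE : h * 2 = 1) (h2 : (2 : K) != 0).
Let h2' : h = 2^-1. Proof. by apply: (mulIf h2); rewrite hE mulVf. Qed.

Lemma r0_inv_quot : x != 0 ->
  r0_inv a (x, y, z, w) =
  quot_point (r0_num h a (x, y, z, w)) x (1, 0, 0, 1)%N.
Proof.
have [n4 n8] := two_neq0_pow h2; rewrite h2' => x0.
by congr (_, _, _, _) => /=; field; rewrite ?oner_neq0 ?x0 ?h2 ?n4.
Qed.

Lemma r1_inv_quot : z != 0 ->
  r1_inv a (x, y, z, w) = quot_point (r1_num a (x, y, z, w)) z (0, 0, 1, 0)%N.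
Proof. by move=> z0; congr (_, _, _, _) => /=; field; rewrite ?oner_neq0 ?z0. Qed.

Lemma r2_inv_quot : x != 0 ->
  r2_inv a t (x, y, z, w) =
  quot_point (r2_num h a t (x, y, z, w)) x (1, 2, 1, 1)%N.
Proof.
have [n4 n8] := two_neq0_pow h2; rewrite h2' => x0.
by congr (_, _, _, _) => /=; field; rewrite ?oner_neq0 ?x0 ?h2 ?n4 ?n8.
Qed.
End Quotients.

Definition var_point (A : nzRingType) : point {mpoly A[4]} :=
  ('X_iq1, 'X_ip1, 'X_iq2, 'X_ip2).

Section Charts.
Variable (F : fieldType).
Hypothesis char0 : [pchar F] =i pred0.
Let n2 : (2 : F) != 0. Proof. by have/pcharf0P-> := char0. Qed.

(** [subst_at] over an arbitrary field of constants. *)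
Definition in_chart (v : point {fraction {mpoly F[4]}}) (H : {mpoly F[4]}) :=
  mmap (fun c => tofrac c%:MP) (coord v) H.

Lemma polar_coef_quot_eq0 (H P : {mpoly F[4]}) (N : point {mpoly F[4]})
    (v : point {fraction {mpoly F[4]}}) (d : point nat) (j : 'I_4)
    (u : point {poly F}) (s : point (seq F)) (k : nat) :
  (msize H <= 4)%N ->
  in_chart v H = tofrac P ->
  v = quot_point (map_point (@tofrac _) N) (tofrac 'X_j) d ->
  map_point (mmap polyC (coord u)) N = map_point Poly s ->
  coord u j = 'X -> (0 < k)%N ->
  polar_coef (coef4 H) d s k = 0.
Proof.
move=> degH HP vE numE uj k_gt0.
apply: (polar_coef_chart_eq0 (N := N) degH HP _ _ uj k_gt0) => i; last first.
  by rewrite -(coord_map_point (mmap polyC (coord u))) numE coord_map_point.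
rewrite vE rmorphXn /= -coord_map_point; case: N {numE vE} => [[[? ?] ?] ?].
by case: d => [[[? ?] ?] ?]; case: i => [[|[|[|[|//]]]] ?].
Qed.

Lemma frac_constE (c : F) :
  tofrac (c%:MP : {mpoly F[4]}) = (@tofrac _ \o @mpolyC 4 F) c.
Proof. by []. Qed.

Lemma half_frac : tofrac ((2^-1)%:MP : {mpoly F[4]}) * 2 = 1.
Proof.
rewrite frac_constE -(rmorph_nat (@tofrac _ \o @mpolyC 4 F) 2) -rmorphM.
by rewrite mulVf ?rmorph1.
Qed.

Lemma two_frac_neq0 : (2 : {fraction {mpoly F[4]}}) != 0.
Proof.
by rewrite -(rmorph_nat (@tofrac _ \o @mpolyC 4 F) 2) /= tofrac_eq0 mpolyC_eq0.
Qed.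

Lemma var_frac_neq0 i : tofrac ('X_i : {mpoly F[4]}) != 0.
Proof. by rewrite tofrac_eq0 -msupp_eq0 msuppX. Qed.

Lemma map_var_point (u : point {poly F}) :
  map_point (mmap polyC (coord u)) (var_point F) = u.
Proof.
by case: u => [[[? ?] ?] ?]; congr (_, _, _, _); rewrite /= mmapX mmap1U.
Qed.

Lemma r0_polar (a : F) (H P : {mpoly F[4]}) : (msize H <= 4)%N ->
  in_chart (r0_inv (tofrac a%:MP) (map_point (@tofrac _) (var_point F))) H
    = tofrac P ->
  forall z w k, (0 < k)%N ->
  polar_coef (coef4 H) (1, 0, 0, 1)%N
    ([:: 1], [:: - (z ^+ 2 / 4); - a], [:: z], [:: - (z / 2); w]) k = 0.
Proof.
move=> degH HP z w k.
apply: (polar_coef_quot_eq0 (j := iq1)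
  (N := r0_num (2^-1)%:MP a%:MP (var_point F)) (u := ('X, 0, z%:P, w%:P)) degH HP) => //.
  rewrite r0_num_morph; apply: r0_inv_quot.
  - exact: half_frac.
  - exact: two_frac_neq0.
  - exact: var_frac_neq0.
rewrite r0_num_morph map_var_point /= !mmapC.
have -> : z ^+ 2 / 4 = 2^-1 ^+ 2 * z ^+ 2.
  by have [n4 _] := two_neq0_pow n2; field; rewrite n2 n4.
by congr (_, _, _, _); rewrite /= ?cons_poly_def; ring.
Qed.

Lemma r1_polar (a : F) (H P : {mpoly F[4]}) : (msize H <= 4)%N ->
  in_chart (r1_inv (tofrac a%:MP) (map_point (@tofrac _) (var_point F))) H
    = tofrac P ->
  forall x y k, (0 < k)%N ->
  polar_coef (coef4 H) (0, 0, 1, 0)%N ([:: x], [:: y], [:: 1], [:: 0; - a]) k = 0.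
Proof.
move=> degH HP x y k.
apply: (polar_coef_quot_eq0 (N := r1_num a%:MP (var_point F)) (j := iq2)
  (u := (x%:P, y%:P, 'X, 0)) degH HP) => //.
  by rewrite r1_num_morph; apply: r1_inv_quot; exact: var_frac_neq0.
rewrite r1_num_morph map_var_point /= !mmapC.
by congr (_, _, _, _); rewrite /= ?cons_poly_def; ring.
Qed.

Lemma r2_polar (a t : F) (H P : {mpoly F[4]}) : (msize H <= 4)%N ->
  in_chart (r2_inv (tofrac a%:MP) (tofrac t%:MP)
              (map_point (@tofrac _) (var_point F))) H = tofrac P ->
  forall z k, (0 < k)%N ->
  polar_coef (coef4 H) (1, 2, 1, 1)%N
    ([:: 1], [:: -1; - z; - t; - a], [:: 2; z], [:: z / 2; z ^+ 2 / 8]) k = 0.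
Proof.
move=> degH HP z k.
apply: (polar_coef_quot_eq0 (j := iq1)
  (N := r2_num (2^-1)%:MP a%:MP t%:MP (var_point F)) (u := ('X, 0, z%:P, 0)) degH HP) => //.
  rewrite r2_num_morph; apply: r2_inv_quot.
  - exact: half_frac.
  - exact: two_frac_neq0.
  - exact: var_frac_neq0.
rewrite r2_num_morph map_var_point /= !mmapC.
have -> : z ^+ 2 / 8 = 2^-1 ^+ 3 * z ^+ 2.
  by have [_ n8] := two_neq0_pow n2; field; rewrite n2 n8.
by congr (_, _, _, _); rewrite /= ?cons_poly_def; ring.
Qed.
End Charts.

(** * The linear equations and their solution *)

Lemma natS_neq0 (F : fieldType) (n : nat) :
  [pchar F] =i pred0 -> (n.+1%:R : F) != 0.
Proof. by move=> char0; have/pcharf0P-> := char0. Qed.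

Lemma divr_natS_eq0 (F : fieldType) (x : F) (n : nat) :
  [pchar F] =i pred0 -> x / n.+1%:R = 0 -> x = 0.
Proof.
move=> char0 /eqP.
by rewrite mulf_eq0 invr_eq0 (negPf (natS_neq0 n char0)) orbF => /eqP.
Qed.

Lemma oppr_divr_natS_eq0 (F : fieldType) (x : F) (n : nat) :
  [pchar F] =i pred0 -> - (x / n.+1%:R) = 0 -> x = 0.
Proof. by move=> char0 /eqP; rewrite oppr_eq0 => /eqP /(divr_natS_eq0 char0). Qed.

Section Solution.
Variables (F : fieldType) (a0 a1 a2 t : F) (c : nat -> nat -> nat -> nat -> F).
Hypothesis char0 : [pchar F] =i pred0.

Definition r1_relations : Prop :=
  [/\ [/\ c 0 0 3 0 = 0, c 0 0 2 0 = 0, c 1 0 2 0 = 0 & c 0 1 2 0 = 0],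
      [/\ c 1 0 1 0 = 0, c 0 1 1 0 = 0, c 2 0 1 0 = 0, c 1 1 1 0 = 0 &
          c 0 2 1 0 = 0] &
      c 0 0 1 0 = a1 * c 0 0 2 1].

(** A monomial q2^k p2^l has a pole of order at most k - l here, so in degree
    three only those with l = 0 < k, together with q2^2 p2 = - w - a1 / z,
    contribute.  As w occurs in regular terms only, it is specialised to 0. *)
Lemma r1_coefs :
  (forall x y k, (0 < k)%N ->
     polar_coef c (0, 0, 1, 0)%N ([:: x], [:: y], [:: 1], [:: 0; - a1]) k = 0) ->
  r1_relations.
Proof.
move=> polar.
have p3 : c 0 0 3 0 = 0.
  (* Unlocking the big operator lets [polar_coef] compute. *)
  by move: (polar 0 0 3%N isT); rewrite /polar_coef unlock /= => <-; ring.
have p2 x y : horner_rec [seq horner_rec r y | r <-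
    [:: [:: c 0 0 2 0; c 0 1 2 0]; [:: c 1 0 2 0]]] x = 0.
  move: (polar x y 2%N isT); rewrite /polar_coef unlock /= p3 => E.
  by rewrite -[RHS]E; ring.
have p1 x y : horner_rec [seq horner_rec r y | r <-
    [:: [:: c 0 0 1 0 - a1 * c 0 0 2 1; c 0 1 1 0; c 0 2 1 0];
        [:: c 1 0 1 0; c 1 1 1 0]; [:: c 2 0 1 0]]] x = 0.
  move: (polar x y 1%N isT); rewrite /polar_coef unlock /= p3 => E.
  by rewrite -[RHS]E; ring.
have [[c0020 [c0120 _]] [[c1020 _] _]] := horner_rec2_eq0 char0 p2.
have [[c0010 [c0110 [c0210 _]]] [[c1010 [c1110 _]] [[c2010 _] _]]] :=
  horner_rec2_eq0 char0 p1.
by split; [split | split | exact: subr0_eq].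
Qed.

Definition r0_relations : Prop :=
  [/\ [/\ c 3 0 0 0 = 0, c 2 0 0 1 = 0, c 1 0 0 2 = 0 & c 0 0 0 3 = 0],
      [/\ c 2 0 0 0 = 0, c 1 0 0 1 = 0, c 0 1 0 2 = 0, c 0 0 1 2 = 0 &
          c 1 1 0 1 = 0],
      c 0 0 0 1 = 0 /\ c 0 2 0 1 = 0,
      [/\ c 1 0 0 0 = a0 * c 2 1 0 0, c 1 0 1 1 = - c 2 1 0 0 &
          c 0 0 0 2 = - c 2 1 0 0] &
      [/\ c 0 0 1 1 = - (c 1 1 0 0 / 2), c 0 1 1 1 = - (c 1 2 0 0 / 2) &
          c 0 0 2 1 = c 0 1 0 1 / 4]].

(** The poles have order at most three, since q1 and p2 have simple poles and
    the other two coordinates none.  As y occurs only through the term - x^2 y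
    of p1, whose cofactors have poles of order at most two, it is specialised
    to 0.  The lists are the expansions in z of the polar coefficients of order
    3, 2, 1, each simplified by the preceding ones; only the last of these
    coefficients still depends on w. *)
Lemma r0_coefs : r1_relations ->
  (forall z w k, (0 < k)%N ->
     polar_coef c (1, 0, 0, 1)%N
       ([:: 1], [:: - (z ^+ 2 / 4); - a0], [:: z], [:: - (z / 2); w]) k = 0) ->
  r0_relations.
Proof.
move=> [[q1 q2 q3 q4] [q5 q6 q7 q8 q9] _] polar.
have r1c := (q1, q2, q3, q4, q5, q6, q7, q8, q9).
have nz := (natS_neq0 1 char0, natS_neq0 3 char0, natS_neq0 7 char0,
            natS_neq0 15 char0, natS_neq0 31 char0).
have p3 z : horner_rec
    [:: c 3 0 0 0; - (c 2 0 0 1 / 2); c 1 0 0 2 / 4; - (c 0 0 0 3 / 8)] z = 0.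
  move: (polar z 0 3%N isT); rewrite /polar_coef unlock /= ?r1c => E.
  by rewrite -[RHS]E; field; rewrite ?nz.
have [c3000 [e2001 [e1002 [e0003 _]]]] := horner_rec_eq0 char0 p3.
have c2001 := oppr_divr_natS_eq0 char0 e2001.
have c1002 := divr_natS_eq0 char0 e1002.
have c0003 := oppr_divr_natS_eq0 char0 e0003.
have p2 z : horner_rec
    [:: c 2 0 0 0; - (c 1 0 0 1 / 2);
        - c 2 1 0 0 / 4 - c 1 0 1 1 / 2 + c 0 0 0 2 / 4;
        c 1 1 0 1 / 8 + c 0 0 1 2 / 4; - (c 0 1 0 2 / 16)] z = 0.
  move: (polar z 0 2%N isT); rewrite /polar_coef unlock /= ?r1c.
  rewrite c3000 c2001 c1002 c0003 => E.
  by rewrite -[RHS]E; field; rewrite ?nz.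
have [c2000 [e1001 [e2z2 [e2z3 [e0102 _]]]]] := horner_rec_eq0 char0 p2.
have c1001 := oppr_divr_natS_eq0 char0 e1001.
have c0102 := oppr_divr_natS_eq0 char0 e0102.
have p1 w z : horner_rec [seq horner_rec r z | r <-
    [:: [:: c 1 0 0 0 - a0 * c 2 1 0 0;
            a0 * c 1 1 0 1 / 2 - c 0 0 0 1 / 2;
            - c 1 1 0 0 / 4 - c 0 0 1 1 / 2;
            c 0 1 0 1 / 8 - c 0 0 2 1 / 2;
            c 1 2 0 0 / 16 + c 0 1 1 1 / 8;
            - (c 0 2 0 1 / 32)];
        [:: 0; c 1 0 1 1 - c 0 0 0 2; - c 1 1 0 1 / 4 - c 0 0 1 2]]] w = 0.
  move: (polar z w 1%N isT); rewrite /polar_coef unlock /= ?r1c.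
  rewrite c3000 c2001 c1002 c0003 c2000 c1001 c0102 => E.
  by rewrite -[RHS]E; field; rewrite ?nz.
have [[e1z0 [e1z1 [e1z2 [e1z3 [e1z4 [e0201 _]]]]]] [[_ [ewz1 [ewz2 _]]] _]] :=
  horner_rec2_eq0 char0 p1.
(* Each relation below is the indicated multiple of one of the equations. *)
have c0012 : c 0 0 1 2 = - c 1 1 0 1 / 4.
  by apply: subr0_eq; rewrite -(mulr0 (-1)) -ewz2; field; rewrite ?nz.
have c1101 : c 1 1 0 1 = 0.
  by rewrite -(mulr0 16) -e2z3 c0012; field; rewrite ?nz.
have c0002 : c 0 0 0 2 = c 1 0 1 1.
  by apply: subr0_eq; rewrite -(mulr0 (-1)) -ewz1; ring.
have c1011 : c 1 0 1 1 = - c 2 1 0 0.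
  by apply: subr0_eq; rewrite -(mulr0 (-4)) -e2z2 c0002; field; rewrite ?nz.
split; split=> //.
- by rewrite c0012 c1101; field; rewrite ?nz.
- by rewrite -(mulr0 (-2)) -e1z1 c1101; field; rewrite ?nz.
- exact: oppr_divr_natS_eq0 e0201.
- exact: subr0_eq.
- by rewrite c0002.
- by apply: subr0_eq; rewrite -(mulr0 (-2)) -e1z2; field; rewrite ?nz.
- by apply: subr0_eq; rewrite -(mulr0 8) -e1z4; field; rewrite ?nz.
- by apply: subr0_eq; rewrite -(mulr0 (-2)) -e1z3; field; rewrite ?nz.
Qed.

(** The indicator of the monomial q1 is the correction term - q1.  The values
    y = w = 0 already determine H up to a constant, and z = 0 is enough down to
    pole order two; in the simple pole the coefficient of z^3 ties p1 p2 to
    q1^2 p1. *)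
Lemma r2_coefs : a0 + a1 + a2 = 1 / 2 -> r1_relations -> r0_relations ->
  (forall z k, (0 < k)%N ->
     polar_coef
       (fun i j k l => c i j k l - ((i, j, k, l) == (1, 0, 0, 0)%N)%:R)
       (1, 2, 1, 1)%N
       ([:: 1], [:: -1; - z; - t; - a2], [:: 2; z], [:: z / 2; z ^+ 2 / 8]) k
     = 0) ->
  [/\ [/\ c 0 3 0 0 = 0, c 1 2 0 0 = 0 & c 1 1 0 0 = 0],
      [/\ c 2 1 0 0 = 2, c 0 2 0 0 = 2 & c 0 1 0 0 = 2 * t] & c 0 1 0 1 = 4].
Proof.
move=> asum [[q1 q2 q3 q4] [q5 q6 q7 q8 q9] q10].
move=> [[s1 s2 s3 s4] [s5 s6 s7 s8 s9] [s10 s11] [s12 s13 s14] [s15 s16 s17]].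
move=> polar.
have nz := (natS_neq0 1 char0, natS_neq0 3 char0, natS_neq0 7 char0).
have r1c := (q1, q2, q3, q4, q5, q6, q7, q8, q9, q10).
have r0c := (s1, s2, s3, s4, s5, s6, s7, s8, s9, s10, s11,
             (s12, s13, s14, s15, s16, s17)).
have c0300 : c 0 3 0 0 = 0.
  apply: oppr_inj; rewrite oppr0.
  move: (polar 0 6%N isT); rewrite /polar_coef unlock /= ?r1c ?r0c => E.
  by rewrite -[RHS]E; field; rewrite ?nz.
have c1200 : c 1 2 0 0 = 0.
  move: (polar 0 5%N isT); rewrite /polar_coef unlock /= ?r1c ?r0c c0300 => E.
  by rewrite -[RHS]E; field; rewrite ?nz.
have c0200 : c 0 2 0 0 = c 2 1 0 0.
  apply: subr0_eq.
  move: (polar 0 4%N isT); rewrite /polar_coef unlock /= ?r1c ?r0c.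
  by rewrite c0300 c1200 => E; rewrite -[RHS]E; field; rewrite ?nz.
have c1100 : c 1 1 0 0 = 0.
  apply: oppr_inj; rewrite oppr0.
  move: (polar 0 3%N isT); rewrite /polar_coef unlock /= ?r1c ?r0c.
  by rewrite c0300 c1200 c0200 => E; rewrite -[RHS]E; field; rewrite ?nz.
have c0100 : c 0 1 0 0 = t * c 2 1 0 0.
  apply/esym/subr0_eq.
  move: (polar 0 2%N isT); rewrite /polar_coef unlock /= ?r1c ?r0c.
  by rewrite c0300 c1200 c0200 c1100 => E; rewrite -[RHS]E; field; rewrite ?nz.
have p1 z : horner_rec
    [:: (a0 + a2) * c 2 1 0 0 + a1 * c 0 1 0 1 / 2 - 1;
        t * c 2 1 0 0 - t * c 0 1 0 1 / 2; 0;
        c 0 1 0 1 / 8 - c 2 1 0 0 / 4] z = 0.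
  move: (polar z 1%N isT); rewrite /polar_coef unlock /= ?r1c ?r0c.
  rewrite c0300 c1200 c0200 c1100 c0100 => E.
  by rewrite -[RHS]E; field; rewrite ?nz.
have [ez0 [_ [_ [ez3 _]]]] := horner_rec_eq0 char0 p1.
have c0101 : c 0 1 0 1 = 2 * c 2 1 0 0.
  by apply: subr0_eq; rewrite -(mulr0 8) -ez3; field; rewrite ?nz.
have c2100 : c 2 1 0 0 = 2.
  apply: subr0_eq; rewrite -(mulr0 2) -ez0 c0101.
  by have -> : a0 = 1 / 2 - a1 - a2; [rewrite -asum; ring | field; rewrite ?nz].
by rewrite c0100 c0200 c0101 c2100; split=> //; [split=> //; ring | ring].
Qed.

End Solution.

(** * Uniqueness of the Hamiltonian *)

Lemma cf_subX (F : comNzRingType) (H : {mpoly F[4]}) (i j k l : nat) :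
  coef4 (H - 'X_iq1) i j k l = coef4 H i j k l - ((i, j, k, l) == (1, 0, 0, 0)%N)%:R.
Proof.
rewrite /coef4 mcoeffB mcoeffX; congr (_ - _%:R).
have -> : U_(iq1)%MM = mnm_point (1, 0, 0, 0)%N.
  by apply/mnmP => u; rewrite mnmE multinomE (tnth_nth 0%N);
     case: u => [[|[|[|[|//]]]] ?].
by rewrite -[mnm4 _ _ _ _]/(mnm_point (i, j, k, l)) (inj_eq mnm_point_inj) eq_sym.
Qed.

(** [target_hamiltonian] over an arbitrary ring of constants, which keeps the
    constants opaque to [ring]. *)
Definition hamiltonian (A : comNzRingType) (a0 a1 t : A) (u : point A) : A :=
  let: (q1, p1, q2, p2) := u in
  2 * (q1 ^+ 2 * p1 + p1 ^+ 2 + t * p1 + a0 * q1)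
  + q2 ^+ 2 * p2 - 2 * p2 ^+ 2 + a1 * q2 + 4 * p1 * p2 - 2 * q1 * q2 * p2.

Lemma mnm_pointX (F : comNzRingType) (e : point nat) :
  'X_[mnm_point e] = 'X_iq1 ^+ e.1.1.1 * 'X_ip1 ^+ e.1.1.2 * 'X_iq2 ^+ e.1.2
                     * 'X_ip2 ^+ e.2 :> {mpoly F[4]}.
Proof.
rewrite mpolyXE_id -(prod_coord_mnm (var_point F)).
by apply: eq_bigr => i _; congr (_ ^+ _); case: i => [[|[|[|[|//]]]] ?];
   congr 'X_[_]; congr U_(_)%MM; apply: val_inj.
Qed.

(** The charts are used in the order r1, r0, r2: the relations from r1 keep the
    expansions in r0 short, and both reduce r2 to seven unknowns. *)
Lemma hamiltonian_unique (F : fieldType) (a0 a1 a2 t : F)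
    (H P0 P1 P2 : {mpoly F[4]}) (v := map_point (@tofrac _) (var_point F)) :
  [pchar F] =i pred0 -> a0 + a1 + a2 = 1 / 2 -> (msize H <= 4)%N ->
  in_chart (r0_inv (tofrac a0%:MP) v) H = tofrac P0 ->
  in_chart (r1_inv (tofrac a1%:MP) v) H = tofrac P1 ->
  in_chart (r2_inv (tofrac a2%:MP) (tofrac t%:MP) v) (H - 'X_iq1) = tofrac P2 ->
  H = hamiltonian a0%:MP a1%:MP t%:MP (var_point F) + (coef4 H 0 0 0 0)%:MP.
Proof.
move=> char0 asum degH HP0 HP1 HP2.
have degH' : (msize (H - 'X_iq1) <= 4)%N.
  apply: leq_trans (mmeasureD_le _ _ _) _.
  by rewrite geq_max degH mmeasureN msizeX mdeg1.
have E1 := r1_coefs char0 (r1_polar degH HP1).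
have E0 := r0_coefs char0 E1 (r0_polar char0 degH HP0).
have polar2 z k : (0 < k)%N -> polar_coef
    (fun i j k l => coef4 H i j k l - ((i, j, k, l) == (1, 0, 0, 0)%N)%:R)
    (1, 2, 1, 1)%N
    ([:: 1], [:: -1; - z; - t; - a2], [:: 2; z], [:: z / 2; z ^+ 2 / 8]) k = 0.
  move=> k_gt0; rewrite -[RHS](r2_polar char0 degH' HP2 z k_gt0).
  by apply: eq_bigr => e _; rewrite cf_subX.
have E2 := r2_coefs char0 asum E1 E0 polar2.
rewrite {1}(cubic_mpolyE degH).
rewrite (eq_bigr (fun e => (coef4 H e.1.1.1 e.1.1.2 e.1.2 e.2)%:MP *
  ('X_iq1 ^+ e.1.1.1 * 'X_ip1 ^+ e.1.1.2 * 'X_iq2 ^+ e.1.2 * 'X_ip2 ^+ e.2)));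
  last first.
  by move=> e _; rewrite mnm_pointX mul_mpolyC.
rewrite /var_point /hamiltonian unlock /=.
move: (coef4 H) E1 E0 E2 'X_iq1 'X_ip1 'X_iq2 'X_ip2 => c.
move=> [[-> -> -> ->] [-> -> -> -> ->] ->].
move=> [[-> -> -> ->] [-> -> -> -> ->] [-> ->] [-> -> ->] [-> -> ->]].
move=> [[-> -> ->] [-> -> ->] ->] q1 p1 q2 p2.
by rewrite divff ?natS_neq0 //; ring.
Qed.

Lemma mderiv_var (n : nat) (A : nzRingType) (i j : 'I_n) :
  ('X_i : {mpoly A[n]})^`M(j) = (i == j)%:R.
Proof.
rewrite mderivX mnm1E; case: eqVneq => [->|_]; last by rewrite scale0r.
rewrite scale1r; have -> : (U_(j) - U_(j))%MM = 0%MM :> 'X_{1..n}.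
  by apply/mnmP => k; rewrite !mnmE subnn.
exact: mpolyX0.
Qed.

Lemma mderiv_nat (n : nat) (A : nzRingType) (m : nat) (i : 'I_n) :
  (m%:R : {mpoly A[n]})^`M(i) = 0.
Proof. by rewrite -mpolyC_nat mderivC. Qed.

Lemma hamiltonian_derivatives (F : fieldType) (a0 a1 t c : F)
    (q1 := 'X_iq1 : {mpoly F[4]}) (p1 := 'X_ip1) (q2 := 'X_iq2) (p2 := 'X_ip2)
    (K := hamiltonian a0%:MP a1%:MP t%:MP (var_point F) + c%:MP) :
  (K^`M(ip1), - K^`M(iq1), K^`M(ip2), - K^`M(iq2)) =
  (2 * q1 ^+ 2 + 4 * p1 + 2 * t%:MP + 4 * p2,
   - 4 * q1 * p1 + 2 * q2 * p2 - 2 * a0%:MP,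
   q2 ^+ 2 - 4 * p2 + 4 * p1 - 2 * q1 * q2,
   - 2 * q2 * p2 + 2 * q1 * p2 - a1%:MP).
Proof.
rewrite /K /hamiltonian /= /q1 /p1 /q2 /p2.
rewrite !(mderivD, mderivN, mderivM, mderivC, mderiv_nat, mderiv_var, expr2) /=.
by congr (_, _, _, _); ring.
Qed.

Lemma Ct_char0 (R : realType) : [pchar Ct R] =i pred0.
Proof.
apply/pcharf0P => n.
rewrite -(rmorph_nat (@tofrac {poly R[i]})) tofrac_eq0 -polyC_natr polyC_eq0.
by rewrite Num.Theory.pnatr_eq0.
Qed.

Theorem theorem2p4 (R : realType) (a0 a1 a2 : R[i])
    (H : {mpoly (Ct R)[4]}) :
  a0 + a1 + a2 = 1 / 2 ->
  condA1 H ->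
  condA2 a0 a1 a2 H ->
  hamiltonian_system H = target_system a0 a1 /\
  exists c : Ct R, H = target_hamiltonian a0 a1 + c%:MP.
Proof.
move=> asum degH [[P0 HP0] [P1 HP1] [P2 HP2]].
have asum' : cst a0 + cst a1 + cst a2 = 1 / 2.
  rewrite /cst -!tofracD -!polyCD asum.
  have n2 : (2 : R[i]) != 0 by rewrite Num.Theory.pnatr_eq0.
  have n2' : (2 : Ct R) != 0 by have/pcharf0P-> := @Ct_char0 R.
  apply: (mulIf n2'); rewrite divfK // -(rmorph_nat (@tofrac {poly R[i]}) 2).
  by rewrite -tofracM -polyC_natr -polyCM divfK // tofrac1.
have HE : H = target_hamiltonian a0 a1 + (coef4 H 0 0 0 0)%:MP.
  by apply: (hamiltonian_unique (@Ct_char0 R) asum' _ HP0 HP1 HP2); rewrite degH.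
split; last by exists (coef4 H 0 0 0 0).
by rewrite HE; exact: hamiltonian_derivatives.
Qed.
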